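(* Let $\omega$ be a complete congruence relation on a semigroup $S$, and let $P^{\Box}$ be a cubic Pythagorean fuzzy interior ideal of $S$. Then the lower approximation $\underline{App}(P^{\Box})$ is a cubic Pythagorean fuzzy interior ideal of $S$.
   Context: Congruence: an equivalence relation $\omega$ on $S$ is a congruence relation if $(z_1,z_2)\in\omega$ implies $(z_1x,z_2x)\in\omega$ and $(xz_1,xz_2)\in\omega$ for all $x\in S$. $[z]_\omega$ denotes the class of $z$; $\omega$ is complete if $[z_1]_\omega[z_2]_\omega=[z_1z_2]_\omega$ for all $z_1,z_2\in S$. Intervals: closed subintervals $[a^-,a^+]$ of $[0,1]$ are ordered componentwise; infima $\bigwedge$ and suprema $\bigvee$ are taken componentwise. A cubic Pythagorean fuzzy set (CPFS) on $S$ is $P^{\Box}=\{\langle z,[\zeta_{\widetilde p}(z),\eta_{\widetilde p}(z)],(\zeta_p(z),\eta_p(z))\rangle : z\in S\}$, where $\zeta_{\widetilde p}(z)=[\zeta_p^-(z),\zeta_p^+(z)]$ and $\eta_{\widetilde p}(z)=[\eta_p^-(z),\eta_p^+(z)]$ are closed subintervals of $[0,1]$ with $(\zeta_p^+(z))^2+(\eta_p^+(z))^2\le 1$, and $\zeta_p(z),\eta_p(z)\in[0,1]$ with $\zeta_p(z)^2+\eta_p(z)^2\le 1$. Here $\zeta_p,\eta_p$ are independent data. A CPFS is a cubic Pythagorean fuzzy interior ideal of $S$ if for all $x,y,z\in S$: $\zeta_{\widetilde p}(xyz)\ge\zeta_{\widetilde p}(y)$, $\eta_{\widetilde p}(xyz)\ge\eta_{\widetilde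 p}(y)$, $\zeta_p(xyz)\le\zeta_p(y)$, $\eta_p(xyz)\le\eta_p(y)$. Lower approximation $\underline{App}(P^{\Box})$: it has components $\underline{\zeta_{\widetilde p}}(z)=\bigwedge_{z'\in[z]_\omega}\zeta_{\widetilde p}(z')$, $\underline{\eta_{\widetilde p}}(z)=\bigvee_{z'\in[z]_\omega}\eta_{\widetilde p}(z')$, $\underline{\zeta_p}(z)=\bigwedge_{z'\in[z]_\omega}\zeta_p(z')$, $\underline{\eta_p}(z)=\bigvee_{z'\in[z]_\omega}\eta_p(z')$. *)

(* Defs.v *)
From HB Require Import structures.
From Stdlib Require Import RelationClasses.
From mathcomp Require Import all_boot all_order all_algebra.
From mathcomp Require Import classical_sets reals.
Set Implicit Arguments.
Unset Strict Implicit.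
Unset Printing Implicit Defensive.
Import Order.TTheory GRing.Theory Num.Theory.
Local Open Scope classical_set_scope.
Local Open Scope ring_scope.

Section Congruence.
Variable S : semigroupType.
Implicit Type omega : S -> S -> Prop.

Definition is_congruence omega : Prop :=
  Equivalence omega /\
  forall z1 z2 : S, omega z1 z2 -> forall x : S,
    omega (z1 * x)%g (z2 * x)%g /\ omega (x * z1)%g (x * z2)%g.

Definition cong_class omega (z : S) : set S := [set z' | omega z z'].

Definition is_complete omega : Prop :=
  forall z1 z2 : S,
    [set (a * b)%g | a in cong_class omega z1 & b in cong_class omega z2] =
    cong_class omega (z1 * z2)%g.

Definition is_complete_congruence omega : Prop :=
  is_congruence omega /\ is_complete omega.

End Congruence.

Section Intervals.
Variable R : realType.

(* A pair of endpoints; that it is a genuine closed subinterval of [0,1] is the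
   separate predicate [sub01]. *)
Record itvR := ItvR { lo : R; hi : R }.

Definition sub01 (a : itvR) : Prop := [/\ 0 <= lo a, lo a <= hi a & hi a <= 1].

Definition itv_le (a b : itvR) : Prop := lo a <= lo b /\ hi a <= hi b.

(* [inf] and [sup] of a subset of R are its true bounds when it is nonempty and
   bounded on the relevant side; this holds for the images, under maps into
   [0,1], of the classes of an equivalence relation. *)
Definition itv_inf (A : set itvR) : itvR := ItvR (inf (lo @` A)) (inf (hi @` A)).

Definition itv_sup (A : set itvR) : itvR := ItvR (sup (lo @` A)) (sup (hi @` A)).

End Intervals.

Section CPFS.
Variables (R : realType) (S : semigroupType).

(* The interval-valued memberships [zetaI], [etaI] and the real-valued ones
   [zeta], [eta] are independent data, constrained by [is_CPFS]. *)
Record cubic_data := CubicData {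
  zetaI : S -> itvR R;
  etaI : S -> itvR R;
  zeta : S -> R;
  eta : S -> R }.

Definition is_CPFS (P : cubic_data) : Prop :=
  forall z : S,
    [/\ sub01 (zetaI P z) /\ sub01 (etaI P z),
        hi (zetaI P z) ^+ 2 + hi (etaI P z) ^+ 2 <= 1,
        (0 <= zeta P z <= 1) /\ (0 <= eta P z <= 1) &
        zeta P z ^+ 2 + eta P z ^+ 2 <= 1].

Definition is_CPF_interior_ideal (P : cubic_data) : Prop :=
  is_CPFS P /\
  forall x y z : S,
    [/\ itv_le (zetaI P y) (zetaI P (x * y * z)%g),
        itv_le (etaI P y) (etaI P (x * y * z)%g),
        zeta P (x * y * z)%g <= zeta P y &
        eta P (x * y * z)%g <= eta P y].

Definition lower_App (omega : S -> S -> Prop) (P : cubic_data) : cubic_data :=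
  CubicData
    (fun z => itv_inf (zetaI P @` cong_class omega z))
    (fun z => itv_sup (etaI P @` cong_class omega z))
    (fun z => inf (zeta P @` cong_class omega z))
    (fun z => sup (eta P @` cong_class omega z)).

End CPFS.

(* Main.v *)
(** By completeness, [[xyz] = [x][y][z]], so each element of [[xyz]] is a
    product [abc] with [b] in [[y]]; by the congruence property alone,
    [xbz] lies in [[xyz]] for each [b] in [[y]].  The first fact transfers the
    interior ideal inequalities to the infimum of [zetaI] and the supremum of
    [eta], the second to the supremum of [etaI] and the infimum of [zeta].
    The Pythagorean condition survives because one component is lowered to its
    infimum [m] over the class, where the other is everywhere at most
    [sqrt (1 - m^2)]. *)
Require Import Defs.
From mathcomp Require Import all_boot all_order all_algebra.
From mathcomp Require Import classical_sets reals.
From mathcomp Require Import lra.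
Import Order.TTheory GRing.Theory Num.Theory.
Local Open Scope classical_set_scope.
Local Open Scope ring_scope.

Section ImageBounds.
Context {R : realType} {T : Type}.
Implicit Types (A B : set T) (f g : T -> R).

Lemma ge_inf_image A f x : (forall t, 0 <= f t <= 1) -> A x ->
  inf (f @` A) <= f x.
Proof.
move=> f01 Ax; apply: ge_inf; last by exists x.
by exists 0 => _ [t _ <-]; case/andP: (f01 t).
Qed.

Lemma le_sup_image A f x : (forall t, 0 <= f t <= 1) -> A x ->
  f x <= sup (f @` A).
Proof.
move=> f01 Ax; apply: ub_le_sup; last by exists x.
by exists 1 => _ [t _ <-]; case/andP: (f01 t).
Qed.

(** Each value of [g] on [B] dominates some value of [f] on [A], hence dominates the infimum of [f].
    [B] must be nonempty because [inf] of the empty set defaults to 0. *)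
Lemma le_inf_image A B f g : (forall t, 0 <= f t <= 1) -> B !=set0 ->
  (forall b, B b -> exists2 a, A a & f a <= g b) ->
  inf (f @` A) <= inf (g @` B).
Proof.
move=> f01 [b0 Bb0] fg; apply: lb_le_inf; first by exists (g b0); exists b0.
move=> _ [b /fg[a Aa le_ab] <-]; exact: le_trans (ge_inf_image _ _ _ f01 Aa) _.
Qed.

Lemma sup_image_le A B f g : (forall t, 0 <= g t <= 1) -> A !=set0 ->
  (forall a, A a -> exists2 b, B b & f a <= g b) ->
  sup (f @` A) <= sup (g @` B).
Proof.
move=> g01 [a0 Aa0] fg; apply: ge_sup; first by exists (f a0); exists a0.
move=> _ [a /fg[b Bb le_ab] <-]; exact: le_trans (le_sup_image _ _ _ g01 Bb).
Qed.

Lemma inf_image_01 A f : (forall t, 0 <= f t <= 1) -> A !=set0 ->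
  0 <= inf (f @` A) <= 1.
Proof.
move=> f01 [x Ax]; apply/andP; split.
  apply: lb_le_inf; first by exists (f x); exists x.
  by move=> _ [t _ <-]; case/andP: (f01 t).
by apply: le_trans (ge_inf_image _ _ _ f01 Ax) _; case/andP: (f01 x).
Qed.

Lemma sup_image_01 A f : (forall t, 0 <= f t <= 1) -> A !=set0 ->
  0 <= sup (f @` A) <= 1.
Proof.
move=> f01 [x Ax]; apply/andP; split.
  by apply: le_trans (le_sup_image _ _ _ f01 Ax); case/andP: (f01 x).
apply: ge_sup; first by exists (f x); exists x.
by move=> _ [t _ <-]; case/andP: (f01 t).
Qed.

Lemma pythagorean_inf_sup A f g : (forall t, 0 <= f t <= 1) ->
  (forall t, 0 <= g t <= 1) -> A !=set0 ->
  (forall t, f t ^+ 2 + g t ^+ 2 <= 1) ->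
  inf (f @` A) ^+ 2 + sup (g @` A) ^+ 2 <= 1.
Proof.
move=> f01 g01 A0 fg; set m := inf _; set s := sup _.
have /andP[m0 m1] : 0 <= m <= 1 by exact: inf_image_01.
have /andP[s0 _] : 0 <= s <= 1 by exact: sup_image_01.
have m2_le1 : 0 <= 1 - m ^+ 2 by rewrite subr_ge0 expr_le1.
(* Passing to the square root makes the bound linear in [s], so it can be checked at each value of
   [g] separately. *)
suff s_le : s <= Num.sqrt (1 - m ^+ 2).
  have : s ^+ 2 <= Num.sqrt (1 - m ^+ 2) ^+ 2.
    by rewrite ler_pXn2r // nnegrE sqrtr_ge0.
  by rewrite sqr_sqrtr //; lra.
have [x Ax] := A0.
apply: ge_sup; first by exists (g x); exists x.
move=> _ [t At <-]; have /andP[g0 _] := g01 t.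
rewrite -(ger0_norm g0) -sqrtr_sqr ler_sqrt //.
have /andP[f0 _] := f01 t.
have : m ^+ 2 <= f t ^+ 2 by rewrite ler_pXn2r // ge_inf_image.
by have := fg t; lra.
Qed.

End ImageBounds.

Section CongruenceClasses.
Context {S : semigroupType} {omega : S -> S -> Prop}.

Lemma cong_class_nonempty z : is_congruence omega -> cong_class omega z !=set0.
Proof. by case=> -[refl _ _] _; exists z; apply: refl. Qed.

Lemma cong_class_mid x y z b : is_congruence omega ->
  cong_class omega y b -> cong_class omega (x * y * z)%g (x * b * z)%g.
Proof. by case=> _ congM /congM/(_ x)[_] /congM/(_ z)[]. Qed.

(** Completeness is used twice, to split [(x * y) * z] and then [x * y]. Only the middle factor is
    tracked, since the interior ideal inequalities hold for arbitrary outer factors. *)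
Lemma complete_class_mid x y z w : is_complete omega ->
  cong_class omega (x * y * z)%g w ->
  exists a b c, cong_class omega y b /\ w = (a * b * c)%g.
Proof.
move=> complete; rewrite -complete => -[u + [c _ <-]].
by rewrite -complete => -[a _ [b yb <-]]; exists a, b, c.
Qed.

End CongruenceClasses.

Theorem theorem4p8 (R : realType) (S : semigroupType) (omega : S -> S -> Prop)
    (P : cubic_data R S) :
  is_complete_congruence omega ->
  is_CPF_interior_ideal P ->
  is_CPF_interior_ideal (lower_App omega P).
Proof.
move=> [cong complete] [cpfs ideal].
have ne z : cong_class omega z !=set0 by exact: cong_class_nonempty.
have sub01W (a : itvR R) : sub01 a -> (0 <= lo a <= 1) /\ (0 <= hi a <= 1).
  by case=> ? ? ?; split; lra.
have zlo t : 0 <= (@lo R \o zetaI P) t <= 1.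
  by have [[/sub01W[]]] := cpfs t.
have zhi t : 0 <= (@hi R \o zetaI P) t <= 1.
  by have [[/sub01W[]]] := cpfs t.
have elo t : 0 <= (@lo R \o etaI P) t <= 1.
  by have [[_ /sub01W[]]] := cpfs t.
have ehi t : 0 <= (@hi R \o etaI P) t <= 1.
  by have [[_ /sub01W[]]] := cpfs t.
have z01 t : 0 <= zeta P t <= 1 by have [_ _ []] := cpfs t.
have e01 t : 0 <= eta P t <= 1 by have [_ _ []] := cpfs t.
(* [image_comp] turns interval bounds into real bounds of the endpoint maps, in the composed form of
   [zlo] to [ehi]. *)
split=> [z|x y z]; rewrite /sub01 /itv_le /= !image_comp.
- have /andP[? _] := inf_image_01 _ _ zlo (ne z).
  have /andP[_ ?] := inf_image_01 _ _ zhi (ne z).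
  have /andP[? _] := sup_image_01 _ _ elo (ne z).
  have /andP[_ ?] := sup_image_01 _ _ ehi (ne z).
  split.
  + split; split=> //.
      by apply: le_inf_image => // t zt; exists t => //; have [[[]]] := cpfs t.
    by apply: sup_image_le => // t zt; exists t => //; have [[_ []]] := cpfs t.
  (* Here the two functions are the upper endpoints of [zetaI] and [etaI]. *)
  + by apply: pythagorean_inf_sup => // t; have [] := cpfs t.
  + by split; [apply: inf_image_01 | apply: sup_image_01].
  + by apply: pythagorean_inf_sup => // t; have [] := cpfs t.
- split; [split | split | |].
  + apply: le_inf_image => // w /(complete_class_mid _ _ _ _ complete).
    by move=> [a [b [c [yb ->]]]]; exists b => //; have [[? ?] _ _ _] := ideal a b c.
  + apply: le_inf_image => // w /(complete_class_mid _ _ _ _ complete).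
    by move=> [a [b [c [yb ->]]]]; exists b => //; have [[? ?] _ _ _] := ideal a b c.
  (* The larger supremum is now over the class of [x * y * z], so each [b] needs a witness there:
     replacing [y] by [b] inside the product gives one. *)
  + apply: sup_image_le => // b yb; exists (x * b * z)%g.
      exact: cong_class_mid.
    by have [_ []] := ideal x b z.
  + apply: sup_image_le => // b yb; exists (x * b * z)%g.
      exact: cong_class_mid.
    by have [_ []] := ideal x b z.
  + apply: le_inf_image => // b yb; exists (x * b * z)%g.
      exact: cong_class_mid.
    by have [] := ideal x b z.
  + apply: sup_image_le => // w /(complete_class_mid _ _ _ _ complete).
    by move=> [a [b [c [yb ->]]]]; exists b => //; have [] := ideal a b c.
Qed.
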